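(* Let $G$ be a group and let $R$ be a commutative ring with a nonzero unity $1$. If $R$ is a Noetherian ring, then any graded ideal of the group ring $R[G]$ is $s$-prime for some $s\in h^*(R)$.
   Context: $e$ denotes the identity of $G$. The group ring $A=R[G]$ is $G$-graded by $A_g=Rg$ for $g\in G$, so that $A_e=R$; $h(A)=\bigcup_{g\in G}A_g$ is the set of homogeneous elements of $A$. Here $h^*(R)$ denotes the set of nonzero elements of $R$, viewed as homogeneous elements of degree $e$ in $A$. An ideal $I$ of $A$ is graded if $I=\bigoplus_{g\in G}(I\cap A_g)$. For a nonzero $s\in h(A)$, a graded ideal $I$ of $A$ is (graded) $s$-prime if $s\notin I$ and, for all $a,b\in h(A)$, $ab\in I$ implies $sa\in I$ or $sb\in I$.
   Formalization: The graded ideal is assumed proper: the graded ideal I = R[G] contains every s, so the requirement that s is not in I fails and the claim is false for it. *)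

(* Defs.v *)
From HB Require Import structures.
From mathcomp Require Import all_boot all_algebra finmap.
From mathcomp Require Export monalg.

Set Implicit Arguments.
Unset Strict Implicit.
Unset Printing Implicit Defensive.

Import GRing.Theory.
Local Open Scope fset_scope.
Local Open Scope ring_scope.

(* The group ring R[G].  [monalg] gives the R-module {malg R[G]} of finitely
   supported functions G -> R for any choiceType G, but its multiplication is
   restricted to [monomType], which excludes nontrivial groups (it requires
   x * y = 1 -> x = 1 /\ y = 1), so the convolution product is defined here. *)
Definition group_ring (R : nzRingType) (G : groupType) := {malg R[G]}.

Section GroupRing.
Context (R : nzRingType) (G : groupType).
Implicit Types (x y z : {malg R[G]}) (c : R) (g h : G).

Definition gr_one : {malg R[G]} := << 1 *g 1%g >>.

Definition gr_mul x y : {malg R[G]} :=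
  \sum_(g <- msupp x) \sum_(h <- msupp y) << x@_g * y@_h *g (g * h)%g >>.

Lemma gr_mulw (d1 d2 : {fset G}) x y :
  msupp x `<=` d1 -> msupp y `<=` d2 ->
  gr_mul x y = \sum_(g <- d1) \sum_(h <- d2) << x@_g * y@_h *g (g * h)%g >>.
Proof.
move=> le_d1 le_d2; rewrite /gr_mul (big_fset_incl _ le_d1) /=.
  apply/eq_bigr=> g _; apply/big_fset_incl => // h _ /mcoeff_outdom ->.
  by rewrite mulr0 monalgU0.
move=> g _ /mcoeff_outdom xg0.
by rewrite big1 => // h _; rewrite xg0 mul0r monalgU0.
Qed.

Lemma gr_mul0 : left_zero 0 gr_mul.
Proof. by move=> x; rewrite /gr_mul msupp0 big_seq_fset0. Qed.

Lemma gr_mulr0 : right_zero 0 gr_mul.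
Proof.
by move=> x; rewrite /gr_mul msupp0 big1 // => g _; rewrite big_seq_fset0.
Qed.

Lemma gr_mulUU c1 c2 g h :
  gr_mul << c1 *g g >> << c2 *g h >> = << c1 * c2 *g (g * h)%g >>.
Proof. by rewrite (gr_mulw msuppU_le msuppU_le) !big_seq_fset1 !mcoeffUU. Qed.

Lemma gr_mulUl c g x :
  gr_mul << c *g g >> x = \sum_(h <- msupp x) << c * x@_h *g (g * h)%g >>.
Proof.
rewrite (gr_mulw msuppU_le (fsubset_refl _)) big_seq_fset1.
by apply/eq_bigr => h _; rewrite mcoeffUU.
Qed.

Lemma gr_mulUr c g x :
  gr_mul x << c *g g >> = \sum_(h <- msupp x) << x@_h * c *g (h * g)%g >>.
Proof.
rewrite (gr_mulw (fsubset_refl _) msuppU_le).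
by apply/eq_bigr => h _; rewrite big_seq_fset1 mcoeffUU.
Qed.

Lemma gr_mul1 : left_id gr_one gr_mul.
Proof.
move=> x; rewrite gr_mulUl [RHS]monalgE.
by apply/eq_bigr=> h _; rewrite mul1r mul1g.
Qed.

Lemma gr_mulr1 : right_id gr_one gr_mul.
Proof.
move=> x; rewrite gr_mulUr [RHS]monalgE.
by apply/eq_bigr=> h _; rewrite mulr1 mulg1.
Qed.

Lemma gr_mulDl : left_distributive gr_mul +%R.
Proof.
move=> x y z.
rewrite (gr_mulw (msuppD_le x y) (fsubset_refl _)).
rewrite (gr_mulw (fsubsetUl (msupp x) (msupp y)) (fsubset_refl (msupp z))).
rewrite (gr_mulw (fsubsetUr (msupp x) (msupp y)) (fsubset_refl (msupp z))).
rewrite -big_split /=; apply/eq_bigr=> g _.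
rewrite -big_split /=; apply/eq_bigr=> h _.
by rewrite mcoeffD mulrDl monalgUD.
Qed.

Lemma gr_mulDr : right_distributive gr_mul +%R.
Proof.
move=> z x y.
rewrite (gr_mulw (fsubset_refl _) (msuppD_le x y)).
rewrite (gr_mulw (fsubset_refl (msupp z)) (fsubsetUl (msupp x) (msupp y))).
rewrite (gr_mulw (fsubset_refl (msupp z)) (fsubsetUr (msupp x) (msupp y))).
rewrite -big_split /=; apply/eq_bigr=> g _.
rewrite -big_split /=; apply/eq_bigr=> h _.
by rewrite mcoeffD mulrDr monalgUD.
Qed.

Lemma gr_mulA : associative gr_mul.
Proof.
have suml (I : Type) (r : seq I) F y :
    gr_mul (\sum_(i <- r) F i) y = \sum_(i <- r) gr_mul (F i) y.
  by apply: (big_morph (gr_mul^~ y)) => [? ?|]; rewrite ?gr_mulDl ?gr_mul0.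
have sumr (I : Type) (r : seq I) F x :
    gr_mul x (\sum_(i <- r) F i) = \sum_(i <- r) gr_mul x (F i).
  by apply: (big_morph (gr_mul x)) => [? ?|]; rewrite ?gr_mulDr ?gr_mulr0.
move: gr_mul suml sumr gr_mulUU => mul suml sumr mulUU x y z.
rewrite [x]monalgE [y]monalgE [z]monalgE !suml; apply: eq_bigr=> g _.
rewrite ![mul << _ *g g >> _]sumr suml; apply: eq_bigr=> h _.
by rewrite !sumr; apply: eq_bigr=> k _; rewrite !mulUU mulrA mulgA.
Qed.

Lemma gr_one_neq0 : gr_one != 0.
Proof. by rewrite monalgU_eq0 oner_eq0. Qed.

HB.instance Definition _ := GRing.Lmodule.on (group_ring R G).
HB.instance Definition _ := GRing.Zmodule_isNzRing.Build (group_ring R G)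
  gr_mulA gr_mul1 gr_mulr1 gr_mulDl gr_mulDr gr_one_neq0.

End GroupRing.

(* Ideals are Prop-valued predicates: the library's boolean ones ([idealr])
   only cover decidable subsets. *)
Definition ideal (A : pzRingType) (I : A -> Prop) : Prop :=
  [/\ I 0, forall a b, I a -> I b -> I (a + b),
      forall r a, I a -> I (r * a) & forall r a, I a -> I (a * r)].

Definition noetherian (R : comNzRingType) : Prop :=
  forall J : R -> Prop, ideal J ->
  exists gens : seq R, forall x, J x <->
    exists c : nat -> R, x = \sum_(i < size gens) c i * gens`_i.

Section Graded.
Context (R : comNzRingType) (G : groupType).
Local Notation A := (group_ring R G).

Definition component (g : G) (x : A) : Prop := exists r : R, x = << r *g g >>.

Definition homogeneous (x : A) : Prop := exists g, component g x.

(* h^*(R) *)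
Definition nonzero_scalar (x : A) : Prop :=
  exists2 r : R, r != 0 & x = << r *g 1%g >>.

(* I is the internal direct sum of the I `&` A_g: its elements are exactly
   those having a unique decomposition as a finitely supported sum. *)
Definition graded (I : A -> Prop) : Prop :=
  forall x, I x <->
    exists! d : {fsfun G -> A with 0},
      (forall g, I (d g) /\ component g (d g)) /\
      x = \sum_(g <- finsupp d) d g.

Definition graded_ideal (I : A -> Prop) : Prop := ideal I /\ graded I.

Definition s_prime (s : A) (I : A -> Prop) : Prop :=
  ~ I s /\
  forall a b, homogeneous a -> homogeneous b ->
    I (a * b) -> I (s * a) \/ I (s * b).

End Graded.

(* Main.v *)
Require Import Defs.
From mathcomp Require Import all_boot all_algebra.
From mathcomp Require Import boolp.

(** A graded ideal [I] of [R[G]] is controlled by its degree-[e] part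
    [J = {r | r e \in I}]: since group elements are units, [r g \in I] iff
    [r \in J].  So it suffices to find [s] outside the proper ideal [J] of [R]
    such that [a b \in J] implies [s a \in J] or [s b \in J].  If [s] fails
    through [a] and [b], then [s a] lies outside [J] and [b] witnesses that
    the colon ideal [(J : s a)] is strictly larger than [(J : s)]; in a
    Noetherian ring this cannot go on forever starting from [s = 1]. *)

Import GRing.Theory.
Local Open Scope ring_scope.

Lemma ideal_sum (A : pzRingType) (J : A -> Prop) (n : nat) (F : 'I_n -> A) :
  ideal J -> (forall i, J (F i)) -> J (\sum_i F i).
Proof. by move=> [J0 JD _ _] JF; elim/big_ind: _. Qed.

(** The union of the chain is an ideal, hence finitely generated; each generator appears at some
    stage, and the maximum of these stages serves as [N]. *)
Lemma noetherian_acc {R : comNzRingType} (K : nat -> R -> Prop) :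
  noetherian R -> (forall n, ideal (K n)) ->
  (forall n x, K n x -> K n.+1 x) ->
  exists N, forall n x, K n x -> K N x.
Proof.
move=> noethR idK stepK.
have monoK m n x : (m <= n)%N -> K m x -> K n x.
  by move=> /subnK <- Kx; elim: (n - m)%N => // k /stepK; rewrite addSn.
have idU : ideal (fun x => exists n, K n x).
  split=> [|a b [m Ka] [n Kb]|r a [n Ka]|r a [n Ka]].
  - by exists 0; have [] := idK 0.
  - exists (maxn m n); have [_ KD _ _] := idK (maxn m n).
    by apply: KD; [apply: monoK Ka; apply: leq_maxl
                  | apply: monoK Kb; apply: leq_maxr].
  - by exists n; have [_ _ KM _] := idK n; apply: KM.
  - by exists n; have [_ _ _ KM] := idK n; apply: KM.
have [gens genU] := noethR _ idU.
have Ugens i : (i < size gens)%N -> exists n, K n gens`_i.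
  (* Kronecker delta coefficients express a generator as a combination of all of them. *)
  move=> lti; apply/genU; exists (fun j => (j == i)%:R).
  rewrite (bigD1 (Ordinal lti)) //= eqxx mul1r big1 ?addr0 // => j neq.
  by rewrite -[_ == i]/(j == Ordinal lti) (negPf neq) mul0r.
have [N KN] : exists N, forall i, (i < size gens)%N -> K N gens`_i.
  elim: (size gens) Ugens => [|k IHk] Uk; first by exists 0.
  have [i /ltnW|M KM] := IHk; first exact: Uk.
  have [n Kn] := Uk k (ltnSn k); exists (maxn M n) => i.
  rewrite ltnS leq_eqVlt => /predU1P[->|/KM].
    by apply: monoK Kn; apply: leq_maxr.
  by apply: monoK; apply: leq_maxl.
exists N => n x Kx; have [c ->] := (genU x).1 (ex_intro _ n Kx).
apply: ideal_sum => // i; have [_ _ KM _] := idK N.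
exact/KM/KN.
Qed.

Lemma ideal_colon (R : comNzRingType) (J : R -> Prop) (s : R) :
  ideal J -> ideal (fun x => J (s * x)).
Proof.
move=> [J0 JD JM _]; split=> [|a b Ja Jb|r a Ja|r a Ja].
- by rewrite mulr0.
- by rewrite mulrDr; apply: JD.
- by rewrite mulrCA; apply: JM.
- by rewrite mulrA mulrC; apply: JM.
Qed.

Lemma noetherian_s_prime {R : comNzRingType} {J : R -> Prop} :
  noetherian R -> ideal J -> ~ J 1 ->
  exists2 s, ~ J s & forall a b, J (a * b) -> J (s * a) \/ J (s * b).
Proof.
move=> noethR idJ J1; apply: contrapT => noS.
have [_ _ JM JMr] := idJ.
(* The premise [~ J s] stands under [exists t] so that [choice] gives a total map [f], to be
   iterated from 1; when [J s] holds, the value is arbitrary. *)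
have /choice[f fP] s : exists t, ~ J s ->
    [/\ ~ J t, forall x, J (s * x) -> J (t * x)
      & exists2 b, ~ J (s * b) & J (t * b)].
  apply: contrapT => noT; apply: noS; exists s => [Js|a b Jab].
    by apply: noT; exists 0 => /(_ Js).
  apply: contrapT => /not_orP[Jsa Jsb]; apply: noT; exists (s * a) => _.
  split=> // [x Jsx|]; first by rewrite mulrAC; apply: JMr.
  by exists b => //; rewrite -mulrA; apply: JM.
pose s n := iter n f 1.
have Js n : ~ J (s n) by elim: n => // n /fP[].
have [||N maxN] := noetherian_acc (fun n x => J (s n * x)) noethR.
- by move=> n; apply: ideal_colon.
- by move=> n x; have [_ + _] := fP _ (Js n); apply.
(* As [s N.+1] is [f (s N)], the witness [b] lies in the colon ideal at stage [N.+1] but not in the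
   one at stage [N]. *)
by have [_ _ [b Jb /(maxN N.+1)]] := fP _ (Js N).
Qed.

Section GroupRingIdeal.
Context {R : comNzRingType} {G : groupType}.
Implicit Types (I : group_ring R G -> Prop) (r : R) (g h : G).

Lemma group_ring_mulUU r t g h :
  (<< r *g g >> : group_ring R G) * << t *g h >> = << r * t *g (g * h)%g >>.
Proof. exact: gr_mulUU. Qed.

(** Right multiplication by the unit [g^-1 * h] moves degree [g] to degree [h] and keeps the
    coefficient. *)
Lemma ideal_monalgU {I r g} h : ideal I -> I << r *g g >> -> I << r *g h >>.
Proof.
move=> [_ _ _ IM] /(IM << 1 *g (g^-1 * h)%g >>).
by rewrite group_ring_mulUU mulr1 mulVKg.
Qed.

Lemma ideal_degree1 {I} : ideal I -> ideal (fun r => I << r *g 1%g >>).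
Proof.
move=> [I0 ID IM IMr]; split=> [|a b|r a|r a].
- by rewrite monalgU0.
- by rewrite monalgUD; apply: ID.
- by move=> /(IM << r *g 1%g >>); rewrite group_ring_mulUU mulg1.
- by move=> /(IMr << r *g 1%g >>); rewrite group_ring_mulUU mulg1.
Qed.

End GroupRingIdeal.

Theorem theorem5p2 (G : groupType) (R : comNzRingType) (R_noeth : noetherian R)
    (I : group_ring R G -> Prop) (I_graded : graded_ideal I)
    (I_proper : ~ (forall a, I a)) :
  exists2 s : group_ring R G, nonzero_scalar s & s_prime s I.
Proof.
have [idI _] := I_graded; have [I0 _ IM _] := idI.
have I1 : ~ I << 1 *g 1%g >>.
  by move=> I1; apply: I_proper => a; rewrite -[a]mulr1; apply: IM.
have [s Is sP] := noetherian_s_prime R_noeth (ideal_degree1 idI) I1.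
exists << s *g 1%g >>.
  exists s => //; apply/eqP => s0; apply: Is.
  by rewrite s0 monalgU0.
split=> // _ _ [g [r ->]] [h [t ->]]; rewrite !group_ring_mulUU !mul1g.
(* The product is shifted to degree 1, where [sP] applies, and the outcome is shifted back to degree
   [g] or [h]. *)
move=> /(ideal_monalgU 1%g idI)/sP[]/ideal_monalgU => [/(_ g idI)|/(_ h idI)].
  by left.
by right.
Qed.
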